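(* Let $T$ be a linear operator in $H$ with $\overline{\operatorname{dom}(T)}=H$. Then for every $\lambda\in W_e(T)$ there exists a sequence of finite-dimensional subspaces $H_n\subset\operatorname{dom}(T)$, $n\in\mathbb N$, such that \[ P_{H_n}\stackrel{s}{\longrightarrow}I\quad\text{and}\quad \operatorname{dist}(\lambda,\sigma(T_{H_n}))\longrightarrow0,\qquad n\to\infty; \] in particular, if $\lambda\in W_e(T)\setminus\sigma(T)$, then $\lambda$ is a spurious eigenvalue of $(T_{H_n})_{n\in\mathbb N}$, i.e. $\lambda\notin\sigma(T)$ and there exist an infinite set $I\subset\mathbb N$ and $\lambda_n\in\sigma(T_{H_n})$, $n\in I$, with $\lambda_n\to\lambda$.
   Context: $H$ is a separable infinite-dimensional complex Hilbert space; $\stackrel{s}{\to}$ denotes strong operator convergence and $x_n\stackrel{w}{\to}x$ weak convergence. For a linear operator $T$ with domain $\operatorname{dom}(T)$, the essential numerical range is $W_e(T)=\{\lambda\in\mathbb C:\exists\,(x_n)\subset\operatorname{dom}(T),\ \|x_n\|=1,\ x_n\stackrel{w}{\to}0,\ \langle Tx_n,x_n\rangle\to\lambda\}$. For a closed subspace $V\subset H$, $P_V$ is the orthogonal projection onto $V$, and if $V\subset\operatorname{dom}(T)$, $T_V:=P_VT|_V$ is the compression of $T$ to $V$, an operator in $V$. $\sigma(\cdot)$ denotes the spectrum. *)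

(* Defs.v *)
From HB Require Import structures.
From mathcomp Require Import all_boot all_order all_algebra.
From mathcomp Require Import all_classical all_reals.
From mathcomp Require Export complex.
Set Implicit Arguments. Unset Strict Implicit. Unset Printing Implicit Defensive.
Import Order.TTheory GRing.Theory Num.Theory.
Local Open Scope ring_scope.
Local Open Scope classical_set_scope.

Section Hilbert.
Variable R : realType.
Local Notation C := (R[i]).
Variable V : lmodType C.
Variable ip : V -> V -> C.

Definition hnorm (x : V) : C := sqrtC (ip x x).

Definition is_inner_product : Prop :=
  [/\ (forall (a : C) (x y z : V), ip (a *: x + y) z = a * ip x z + ip y z),
      (forall x y : V, ip x y = Num.conj (ip y x)),
      (forall x : V, 0 <= ip x x) &
      (forall x : V, ip x x = 0 -> x = 0)].

Definition cvgV (u : nat -> V) (x : V) : Prop :=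
  forall e : C, 0 < e -> exists N : nat, forall n, (N <= n)%N -> hnorm (u n - x) < e.

Definition complete_space : Prop :=
  forall u : nat -> V,
    (forall e : C, 0 < e -> exists N : nat, forall m n, (N <= m)%N -> (N <= n)%N ->
        hnorm (u m - u n) < e) ->
    exists x : V, cvgV u x.

Definition separable_space : Prop :=
  exists d : nat -> V, forall (x : V) (e : C), 0 < e -> exists n, hnorm (x - d n) < e.

Definition infinite_dimensional : Prop :=
  forall n : nat, exists v : 'I_n -> V,
    forall c : 'I_n -> C, \sum_(i < n) c i *: v i = 0 -> forall i, c i = 0.

Definition separable_inf_dim_hilbert : Prop :=
  [/\ is_inner_product, complete_space, separable_space & infinite_dimensional].

Definition lin_subspace (D : set V) : Prop :=
  D 0 /\ forall (a : C) (x y : V), D x -> D y -> D (a *: x + y).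

Definition linear_on (D : set V) (T : V -> V) : Prop :=
  forall (a : C) (x y : V), D x -> D y -> T (a *: x + y) = a *: T x + T y.

Definition dense (D : set V) : Prop :=
  forall (x : V) (e : C), 0 < e -> exists y, D y /\ hnorm (x - y) < e.

Definition weak_to0 (u : nat -> V) : Prop :=
  forall y : V, forall e : C, 0 < e -> exists N : nat, forall n, (N <= n)%N -> `|ip (u n) y| < e.

Definition ess_num_range (D : set V) (T : V -> V) : set C :=
  [set lam | exists x : nat -> V,
     [/\ (forall n, D (x n)), (forall n, hnorm (x n) = 1), weak_to0 x &
         (forall e : C, 0 < e -> exists N : nat, forall n, (N <= n)%N ->
             `|ip (T (x n)) (x n) - lam| < e)]].

(* spectrum of an operator S in the closed subspace M with domain D ⊆ M:
   mu is in the resolvent set iff S - mu : D -> M is bijective with a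
   bounded inverse. *)
Definition resolvent_point (M D : set V) (S : V -> V) (mu : C) : Prop :=
  exists Rinv : V -> V,
    [/\ (forall y, M y -> D (Rinv y) /\ S (Rinv y) - mu *: Rinv y = y),
        (forall x, D x -> Rinv (S x - mu *: x) = x) &
        (exists c : C, forall y, M y -> hnorm (Rinv y) <= c * hnorm y)].

Definition spectrum (M D : set V) (S : V -> V) : set C :=
  [set mu | ~ resolvent_point M D S mu].

Definition fin_dim_subspace (M : set V) : Prop :=
  exists (n : nat) (v : 'I_n -> V),
    M = [set x | exists c : 'I_n -> C, x = \sum_(i < n) c i *: v i].

Definition orth_proj (M : set V) (P : V -> V) : Prop :=
  forall x : V, M (P x) /\ forall y, M y -> ip (x - P x) y = 0.

(* compression T_M = P_M T |_M (as an operator in M with domain M) *)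
Definition compression (P T : V -> V) : V -> V := fun x => P (T x).

Definition compr_spectrum (M : set V) (P T : V -> V) : set C :=
  spectrum M M (compression P T).

(* lam is a spurious eigenvalue of (T_{H_n})_n, where P n = P_{H_n} *)
Definition spurious_eigenvalue (D : set V) (T : V -> V)
    (Hs : nat -> set V) (P : nat -> V -> V) (lam : C) : Prop :=
  ~ spectrum setT D T lam /\
  exists (I : set nat) (mu : nat -> C),
    [/\ infinite_set I,
        (forall n, I n -> compr_spectrum (Hs n) (P n) T (mu n)) &
        (forall e : C, 0 < e -> exists N : nat, forall n, I n -> (N <= n)%N ->
            `|mu n - lam| < e)].

End Hilbert.

(* Main.v *)
(* Let [x_n] be unit vectors in [D], weakly null, with [mu_n = <T x_n, x_n>]
   tending to [lam], and put [psi_n g = <(T - mu_n) g, x_n>].  If a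
   finite-dimensional [M] in [D] contains [y <> 0] with [(T - mu) M] orthogonal to
   [y], then [mu] is in the spectrum of the compression of [T] to [M].  So it
   suffices to find, for any finite set [F] in [D], such an [M] nearly containing
   [F], with [mu] near [lam].
   - If for some [d > 0] and all large [n] some [g] in [D] has
     [|psi_n g| > d |g|], take [y = x_n] and replace each [f] in [F] by
     [f - (psi_n f / psi_n g) g], which [psi_n] kills and which is close to [f]
     because [psi_n f -> 0].
   - Otherwise the functionals [psi_n] are bounded, with arbitrarily small norms
     along a subsequence.  Then [<(T - lam) g, y>] is small uniformly in
     [g] for [y] in the span of finitely many almost orthonormal [x_n], and
     such a unit [y] can be chosen orthogonal to both [F] and [T F]; take
     [M = span (F, y)] and [mu = <T y, y>]. *)
Require Import Defs.
From HB Require Import structures.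
From mathcomp Require Import all_boot all_order all_algebra.
From mathcomp Require Import all_classical all_reals.
From mathcomp Require Import complex.
Import Order.TTheory GRing.Theory Num.Theory.
Local Open Scope ring_scope.
Local Open Scope classical_set_scope.

(** * Elementary inner product geometry *)

Section InnerProduct.
#[local] Set Implicit Arguments.
#[local] Unset Strict Implicit.
Variables (R : realType) (V : lmodType R[i]) (ip : V -> V -> R[i]).
Hypothesis ip_inner : is_inner_product ip.
Local Notation N := (hnorm ip).

Lemma ipDl x y z : ip (x + y) z = ip x z + ip y z.
Proof.
by case: ip_inner => lin _ _ _; rewrite -[x]scale1r lin mul1r scale1r.
Qed.

Lemma ip0l z : ip 0 z = 0.
Proof. by apply: (addrI (ip 0 z)); rewrite -ipDl !addr0. Qed.

Lemma ipZl a x z : ip (a *: x) z = a * ip x z.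
Proof. by case: ip_inner => lin _ _ _; rewrite -[_ *: x]addr0 lin ip0l addr0. Qed.

Lemma ipNl x z : ip (- x) z = - ip x z.
Proof. by rewrite -scaleN1r ipZl mulN1r. Qed.

Lemma ipBl x y z : ip (x - y) z = ip x z - ip y z.
Proof. by rewrite ipDl ipNl. Qed.

Lemma ip_conj x y : ip x y = Num.conj (ip y x).
Proof. by case: ip_inner. Qed.

Lemma ipDr x y z : ip z (x + y) = ip z x + ip z y.
Proof. by rewrite ip_conj ipDl rmorphD /= -!ip_conj. Qed.

Lemma ipZr a x z : ip z (a *: x) = Num.conj a * ip z x.
Proof. by rewrite ip_conj ipZl rmorphM /= -ip_conj. Qed.

Lemma ipBr x y z : ip z (x - y) = ip z x - ip z y.
Proof. by rewrite ipDr -scaleN1r ipZr rmorphN1 mulN1r. Qed.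

Lemma ip0r z : ip z 0 = 0.
Proof. by rewrite ip_conj ip0l rmorph0. Qed.

Lemma ip_norm_sym x y : `|ip x y| = `|ip y x|.
Proof. by rewrite ip_conj norm_conjC. Qed.

Lemma ip_ge0 x : 0 <= ip x x.
Proof. by case: ip_inner. Qed.

Lemma hnorm_sqr x : N x ^+ 2 = ip x x.
Proof. exact: sqrtCK. Qed.

Lemma hnorm_ge0 x : 0 <= N x.
Proof. by rewrite sqrtC_ge0 ip_ge0. Qed.

Lemma hnorm_eq0 x : N x = 0 -> x = 0.
Proof.
by move=> Nx0; case: ip_inner => _ _ _; apply; rewrite -hnorm_sqr Nx0 expr0n.
Qed.

Lemma hnorm_gt0 x : x != 0 -> 0 < N x.
Proof.
move=> x0; rewrite lt_neqAle hnorm_ge0 andbT eq_sym.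
by apply: contra_neq x0 => /hnorm_eq0.
Qed.

Lemma hnorm_scale a x : N (a *: x) = `|a| * N x.
Proof.
rewrite /hnorm ipZl ipZr mulrA -normCK rootCMl ?exprn_ge0 //.
by rewrite sqrCK.
Qed.

Lemma pythagoras x y : ip x y = 0 -> N (x + y) ^+ 2 = N x ^+ 2 + N y ^+ 2.
Proof.
move=> xy; rewrite !hnorm_sqr ipDl !ipDr xy (ip_conj y x) xy rmorph0.
by rewrite addr0 add0r.
Qed.

Lemma hnorm_le_pyth x y : ip x y = 0 -> N y <= N (x + y).
Proof.
move=> xy; rewrite -(@ler_pXn2r _ 2) ?nnegrE ?hnorm_ge0 //.
by rewrite pythagoras // lerDr exprn_ge0 ?hnorm_ge0.
Qed.

(** By Pythagoras, the component [a *: y] of [x] along [y] is no longer than [x]. *)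
Lemma cauchy_schwarz x y : `|ip x y| <= N x * N y.
Proof.
have [->|y0] := eqVneq y 0.
  by rewrite ip0r normr0 mulr_ge0 ?hnorm_ge0.
have ny := hnorm_gt0 y0.
have yy : ip y y != 0 by rewrite -hnorm_sqr expf_neq0 // gt_eqF.
pose a := ip x y / ip y y.
have ort : ip (x - a *: y) (a *: y) = 0.
  by rewrite ipZr ipBl ipZl /a divfK // subrr mulr0.
have := hnorm_le_pyth ort; rewrite subrK hnorm_scale.
rewrite /a normf_div -hnorm_sqr normrX (ger0_norm (hnorm_ge0 y)) => h.
rewrite -ler_pdivrMr //.
by apply: le_trans h; rewrite expr2 invfM -mulrA divfK // gt_eqF.
Qed.

Lemma hnorm_triangle x y : N (x + y) <= N x + N y.
Proof.
rewrite -(@ler_pXn2r _ 2) ?nnegrE ?addr_ge0 ?hnorm_ge0 //.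
have e0 : 0 <= N (x + y) ^+ 2 by rewrite exprn_ge0 ?hnorm_ge0.
rewrite -(ger0_norm e0) hnorm_sqr ipDl !ipDr -!hnorm_sqr.
apply: (le_trans (ler_normD _ _)).
have xy := cauchy_schwarz x y; have yx := cauchy_schwarz y x.
rewrite sqrrD mulr2n -!addrA addrA; apply: lerD.
  apply: (le_trans (ler_normD _ _)).
  by rewrite ger0_norm ?exprn_ge0 ?hnorm_ge0 // lerD2l.
apply: (le_trans (ler_normD _ _)); rewrite (mulrC (N x)).
by rewrite (ger0_norm (exprn_ge0 _ (hnorm_ge0 y))) lerD2r.
Qed.

Lemma hnorm_opp x : N (- x) = N x.
Proof. by rewrite -scaleN1r hnorm_scale normrN1 mul1r. Qed.

Lemma hnorm_distC x y : N (x - y) = N (y - x).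
Proof. by rewrite -hnorm_opp opprB. Qed.

(** * Spans of finite lists, their orthogonal projections, and spectra of compressions *)

Fixpoint lspan (s : seq V) : set V :=
  if s is v :: s' then [set x | exists a y, lspan s' y /\ x = a *: v + y]
  else [set 0].

Lemma fin_dim_lspan s : fin_dim_subspace (lspan s).
Proof.
exists (size s), (fun i => s`_i); apply/seteqP; split.
  elim: s => [|v s IHs] x /=.
    by move=> ->; exists (fun=> 0); rewrite big_ord0.
  case=> a [y [/IHs [c ->] ->]].
  exists (fun i => if unlift ord0 i is Some j then c j else a).
  rewrite big_ord_recl unlift_none; congr (_ + _).
  by apply: eq_bigr => i _; rewrite liftK.
elim: s => [|v s IHs] x /= [c ->]; first by rewrite big_ord0.
rewrite big_ord_recl; exists (c ord0), (\sum_(i < size s) c (lift ord0 i) *: s`_i).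
by split=> //; apply: IHs; exists (fun i => c (lift ord0 i)).
Qed.

Lemma lspan_lin s : lin_subspace (lspan s).
Proof.
elim: s => [|v s [IH0 IHl]] /=.
  by split=> // a x y -> ->; rewrite scaler0 addr0.
split; first by exists 0, 0; rewrite scale0r addr0.
move=> a x y [b [x' [sx ->]]] [c [y' [sy ->]]].
exists (a * b + c), (a *: x' + y'); split; first exact: IHl.
by rewrite scalerDr scalerDl scalerA addrACA.
Qed.

Lemma lspan_min s (D : set V) :
  lin_subspace D -> (forall v, v \in s -> D v) -> lspan s `<=` D.
Proof.
move=> [D0 Dl]; elim: s => [|v s IHs] sD x /=; first by move=> ->.
case=> a [y [sy ->]]; apply: Dl; first by apply: sD; rewrite mem_head.
by apply: IHs sy => w ws; apply: sD; rewrite inE ws orbT.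
Qed.

Lemma mem_lspan s v : v \in s -> lspan s v.
Proof.
elim: s => // w s IHs; rewrite inE => /orP [/eqP ->|/IHs sv] /=.
  by exists 1, 0; rewrite scale1r addr0; split=> //; case: (lspan_lin s).
by exists 0, v; rewrite scale0r add0r.
Qed.

(** One Gram-Schmidt step per vector: [w] is the part of [v] orthogonal to the earlier span, and the
    new projection adds the component along [w]. If [w = 0], the added term vanishes. *)
Lemma orth_proj_lspan s : exists P, orth_proj ip (lspan s) P.
Proof.
elim: s => [|v s [P HP]] /=.
  by exists (fun=> 0) => x; split=> // y ->; rewrite ip0r.
have [s0 sl] := lspan_lin s.
pose w := v - P v.
have w_orth y : lspan s y -> ip w y = 0 by move=> sy; have [_ ->] := HP v.
exists (fun x => P x + (ip x w / ip w w) *: w) => x.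
have [sPx ortx] := HP x; have [sPv ortv] := HP v.
split.
  exists (ip x w / ip w w), (P x - (ip x w / ip w w) *: P v).
  split; first by rewrite addrC -scaleNr; exact: sl.
  by rewrite /w scalerBr addrCA addrA addrAC.
move=> _ [a [y [sy ->]]].
set b := ip x w / ip w w.
have ortPw z : lspan s z -> ip (x - (P x + b *: w)) z = 0.
  by move=> sz; rewrite opprD addrA ipBl ortx // ipZl w_orth // mulr0 subrr.
have ortw : ip (x - (P x + b *: w)) w = 0.
  rewrite opprD addrA !ipBl ipZl (ip_conj (P x)) w_orth // rmorph0 subr0 /b.
  have [->|w0] := eqVneq w 0; first by rewrite !ip0r mulr0 subrr.
  by rewrite divfK ?subrr // -hnorm_sqr expf_neq0 // gt_eqF // hnorm_gt0.
rewrite ipDr (ortPw y) // addr0 ipZr -[v](subrK (P v)) ipDr (ortPw (P v)) //.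
by rewrite -/w ortw addr0 mulr0.
Qed.

Lemma orth_proj_best M P x y : lin_subspace M -> orth_proj ip M P -> M y ->
  N (P x - x) <= N (x - y).
Proof.
move=> [M0 Ml] HP My; have [MPx ort] := HP x.
rewrite hnorm_distC.
have -> : x - y = (P x - y) + (x - P x) by rewrite [RHS]addrC subrKA.
apply: hnorm_le_pyth; rewrite ip_conj ort ?rmorph0 //.
by rewrite addrC -scaleN1r; exact: Ml.
Qed.

(* The operator [P (T _) - mu] maps [M] into the orthogonal complement of [y],
   so it misses [y] itself. *)
Lemma compr_spectrum_orth M P (T : V -> V) mu y : orth_proj ip M P ->
    M y -> y != 0 -> (forall g, M g -> ip (T g - mu *: g) y = 0) ->
  compr_spectrum ip M P T mu.
Proof.
move=> HP My y0 ort [S [inv _ _]]; have [MS eqS] := inv y My.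
have := ort _ MS; have [_ /(_ y My)] := HP (T (S y)).
rewrite ipBl => /subr0_eq eqT; rewrite ipBl eqT -ipBl [X in ip X _]eqS.
by move/eqP; rewrite -hnorm_sqr expf_eq0 gt_eqF // hnorm_gt0.
Qed.

(** Near-orthogonality keeps [z = y1 - c *: y2] away from 0: pairing it with [y1] leaves at least 1
    - 1/2, so [N z >= 1/2]. In the factor 4, one 2 comes from adding two bounds and the other from
    dividing by [N z]. *)
Lemma normalized_combination y1 y2 (c : R[i]) : N y1 = 1 -> `|ip y1 y2| <= 2^-1 ->
    `|c| <= 1 ->
  exists a, N (a *: (y1 - c *: y2)) = 1 /\
    forall v (b : R[i]), `|ip v y1| <= b -> `|ip v y2| <= b ->
      `|ip v (a *: (y1 - c *: y2))| <= b *+ 4.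
Proof.
move=> Ny1 y12 c1; set z := y1 - c *: y2.
have half_Nz : 2^-1 <= N z.
  have := cauchy_schwarz z y1; rewrite Ny1 mulr1; apply: le_trans.
  rewrite ipBl -hnorm_sqr Ny1 expr1n ipZl; apply: le_trans (lerB_dist _ _).
  rewrite normr1 lerBrDr addrC -lerBrDr.
  have -> : 1 - 2^-1 = 2^-1 :> R[i] by rewrite [X in X - _](splitr 1) mul1r addrK.
  by rewrite normrM ip_norm_sym; apply: le_trans y12; rewrite ler_piMl.
have Nz : 0 < N z by apply: lt_le_trans half_Nz; rewrite invr_gt0.
exists (N z)^-1; rewrite hnorm_scale gtr0_norm ?invr_gt0 //.
rewrite mulVf ?gt_eqF //; split=> //.
move=> v b vb1 vb2; rewrite ipZr normrM norm_conjC.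
rewrite (@gtr0_norm _ (N z)^-1) ?invr_gt0 //.
have b0 : 0 <= b by apply: le_trans vb1.
have : `|ip v z| <= b *+ 2.
  rewrite ipBr ipZr mulr2n; apply: (le_trans (ler_normB _ _)); apply: lerD => //.
  by rewrite normrM norm_conjC; apply: le_trans vb2; rewrite ler_piMl.
move=> vz; rewrite ler_pdivrMl //; apply: (le_trans vz).
have -> : b *+ 2 = 2^-1 * (b *+ 4).
  by rewrite -[4%N]/(2 * 2)%N mulrnA -[b *+ 2 *+ 2]mulr_natl mulKf ?pnatr_eq0.
by rewrite ler_wpM2r // mulrn_wge0.
Qed.

End InnerProduct.

Lemma eventually_all {A : eqType} (s : seq A) {P : A -> nat -> Prop} :
    (forall a, exists N, forall n, (N <= n)%N -> P a n) ->
  exists N, forall n, (N <= n)%N -> forall a, a \in s -> P a n.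
Proof.
move=> evP; elim: s => [|a s [N HN]]; first by exists 0.
have [N' HN'] := evP a; exists (maxn N N') => n; rewrite geq_max => /andP[n1 n2] b.
by rewrite inE => /orP[/eqP ->|]; [exact: HN' | exact: HN].
Qed.

(** * Finite lists in [D] whose span has a compression eigenvalue near [lam] *)

Section Pollution.
#[local] Set Implicit Arguments.
#[local] Unset Strict Implicit.
Variables (R : realType) (V : lmodType R[i]) (ip : V -> V -> R[i]).
Hypothesis ip_inner : is_inner_product ip.
Variables (D : set V) (T : V -> V).
Hypothesis D_lin : lin_subspace D.
Hypothesis T_lin : linear_on D T.
Local Notation N := (hnorm ip).

Lemma lin_subspace_sum (E : set V) (a : R[i]) x y :
  lin_subspace E -> E x -> E y -> E (a *: x + y).
Proof. by case=> _; apply. Qed.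

Lemma lin_subspaceZ (E : set V) (a : R[i]) x : lin_subspace E -> E x -> E (a *: x).
Proof. by case=> E0 El Ex; rewrite -[_ *: _]addr0; exact: El. Qed.

Lemma linear_on0 : T 0 = 0.
Proof.
have [D0 _] := D_lin; have := T_lin (-1) D0 D0.
by rewrite scaleN1r oppr0 addr0 scaleN1r addNr.
Qed.

Definition shifted (mu : R[i]) x := T x - mu *: x.

Lemma shifted_lin mu a x y : D x -> D y ->
  shifted mu (a *: x + y) = a *: shifted mu x + shifted mu y.
Proof.
move=> Dx Dy; rewrite /shifted T_lin // !scalerDr scalerN scalerA mulrC -scalerA.
by rewrite opprD addrACA.
Qed.

Lemma shifted_orth_lspan mu s y : (forall v, v \in s -> D v) ->
    (forall v, v \in s -> ip (shifted mu v) y = 0) ->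
  forall g, lspan s g -> ip (shifted mu g) y = 0.
Proof.
elim: s => [|v s IHs] sD ort g /=.
  by move=> ->; rewrite /shifted linear_on0 scaler0 subr0 ip0l.
have sD' w : w \in s -> D w by move=> ws; apply: sD; rewrite inE ws orbT.
case=> a [z [sz ->]]; rewrite shifted_lin; last 2 first.
- by apply: sD; rewrite mem_head.
- exact: lspan_min sz.
rewrite ipDl // ipZl // ort ?mem_head // mulr0 add0r IHs // => w ws.
by apply: ort; rewrite inE ws orbT.
Qed.

(* The last clause says that [y] is an eigenvector of the adjoint of the
   compression to [lspan s], for the conjugate of [mu]. *)
Definition polluting lam (fs : seq V) (e : R[i]) (s : seq V) mu :=
  [/\ forall v, v \in s -> D v, `|lam - mu| < e,
      forall f, f \in fs -> exists2 g, g \in s & N (f - g) < e &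
      exists y, [/\ y \in s, y != 0 &
        forall v, v \in s -> ip (shifted mu v) y = 0]].

Section Sequence.
Variables (lam : R[i]) (x : nat -> V).
Hypothesis xD : forall n, D (x n).
Hypothesis x_unit : forall n, N (x n) = 1.
Hypothesis x_weak : weak_to0 ip x.
Local Notation mu := (fun n => ip (T (x n)) (x n)).
Hypothesis mu_lim : forall e : R[i], 0 < e ->
  exists n0, forall n, (n0 <= n)%N -> `|mu n - lam| < e.

Local Notation psi n g := (ip (shifted (mu n) g) (x n)).

Lemma ip_weak y (e : R[i]) :
  0 < e -> exists n0, forall n, (n0 <= n)%N -> `|ip y (x n)| < e.
Proof.
by move=> /(x_weak y)[n0 h]; exists n0 => n /h; rewrite ip_norm_sym.
Qed.

Lemma psi_x n : psi n (x n) = 0.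
Proof. by rewrite /shifted ipBl // ipZl // -hnorm_sqr // x_unit expr1n mulr1 subrr. Qed.

(** Weak nullity sends both [ip (T f) (x n)] and [ip f (x n)] to 0, and eventually
    [|mu n| <= |lam| + 1]. *)
Lemma psi_to0 f (e : R[i]) :
  0 < e -> exists n0, forall n, (n0 <= n)%N -> `|psi n f| < e.
Proof.
move=> e0; have e2 : 0 < e / 2 by rewrite divr_gt0.
have l0 : 0 < `|lam| + 1 by rewrite ltr_wpDl.
have [n1 h1] := ip_weak (T f) e2.
have [n2 h2] := ip_weak f (divr_gt0 e2 l0).
have [n3 h3] := mu_lim (@ltr01 R[i]).
exists (maxn n1 (maxn n2 n3)) => n.
rewrite !geq_max => /and3P[/h1 {}h1 /h2 {}h2 /h3 {}h3].
rewrite /shifted ipBl // ipZl // [e]splitr.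
apply: (le_lt_trans (ler_normB _ _)); apply: ltrD => //.
rewrite normrM; apply: (@le_lt_trans _ _ ((`|lam| + 1) * `|ip f (x n)|)).
  apply: ler_wpM2r => //; rewrite addrC -lerBlDr.
  exact: le_trans (lerB_dist _ _) (ltW h3).
by rewrite mulrC -ltr_pdivlMr.
Qed.

Lemma polluting_nonvanishing (d e : R[i]) n0 (fs : seq V) : 0 < d ->
    (forall n, (n0 <= n)%N -> exists2 g, D g & d * N g < `|psi n g|) ->
    (forall f, f \in fs -> D f) -> 0 < e ->
  exists s m, polluting lam fs e s m.
Proof.
move=> d0 big fsD e0.
(* With threshold [e * d], the correction has norm [|psi n f| / |psi n g| * N g < e], since
   [d * N g < |psi n g|]. *)
have [n1 h1] := eventually_all fs (fun f => psi_to0 f (mulr_gt0 e0 d0)).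
have [n2 h2] := mu_lim e0.
pose n := maxn n0 (maxn n1 n2).
have [g Dg psig] := big n (leq_maxl _ _).
have {}h1 := h1 n (leq_trans (leq_maxl _ _) (leq_maxr _ _)).
have {}h2 := h2 n (leq_trans (leq_maxr _ _) (leq_maxr _ _)).
have pg0 : 0 < `|psi n g|.
  by apply: le_lt_trans psig; rewrite mulr_ge0 ?hnorm_ge0 // ltW.
pose corr f := (- (psi n f / psi n g)) *: g + f.
have corrD f : D f -> D (corr f) by exact: lin_subspace_sum.
exists (x n :: map corr fs), (mu n); split.
- move=> v; rewrite inE => /orP[/eqP -> //|/mapP[f ffs ->]].
  by apply: corrD; exact: fsD.
- by rewrite distrC.
- move=> f ffs; exists (corr f); first by rewrite inE map_f ?orbT.
  rewrite /corr opprD addrCA subrr addr0 hnorm_opp // hnorm_scale // normrN.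
  rewrite normf_div mulrAC ltr_pdivrMr //.
  apply: (@le_lt_trans _ _ (e * d * N g)).
    by rewrite ler_wpM2r ?hnorm_ge0 // ltW // h1.
  by rewrite -mulrA ltr_pM2l.
exists (x n); split; first exact: mem_head.
  apply: contra_eq_neq (x_unit n) => ->.
  by rewrite /hnorm ip0l // sqrtC0 eq_sym oner_eq0.
move=> v; rewrite inE => /orP[/eqP ->|/mapP[f ffs ->]]; first exact: psi_x.
rewrite shifted_lin //; last exact: fsD.
rewrite ipDl // ipZl // mulNr divfK ?addNr //.
by rewrite -normr_gt0.
Qed.

Section Vanishing.
Hypothesis psi_small : forall (d : R[i]) n0, 0 < d ->
  exists2 n, (n0 <= n)%N & forall g, D g -> `|psi n g| <= d * N g.

(** Induction on the exact constraints [hs]: two almost orthogonal solutions for the shorter list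
    are combined so as to cancel the pairing with the new vector [h]. The approximate constraints
    [ts] serve to make the second solution almost orthogonal to the first. *)
Lemma approx_orth (hs : seq V) (e : R[i]) (ts : seq V) : 0 < e ->
  exists y, [/\ D y, N y = 1, forall h, h \in hs -> ip h y = 0,
    forall g, D g -> `|ip (shifted lam g) y| <= e * N g &
    forall t, t \in ts -> `|ip t y| <= e].
Proof.
elim: hs e ts => [|h hs IHhs] e ts e0.
  have e2 : 0 < e / 2 by rewrite divr_gt0.
  have [n1 h1] := eventually_all ts (fun t => ip_weak t e0).
  have [n2 h2] := mu_lim e2.
  have [n] := psi_small (maxn n1 n2) e2.
  rewrite geq_max => /andP[/h1{}h1 /h2{}h2] psi_n.
  exists (x n); split=> // [g Dg|t ts_t]; last by rewrite ltW // h1.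
  (* Passing from [mu n] to [lam] costs [|mu n - lam| * N g], which takes the second half of [e]. *)
  have -> : shifted lam g = shifted (mu n) g + (mu n - lam) *: g.
    by rewrite /shifted scalerBl addrA subrK.
  rewrite ipDl // ipZl // [e]splitr [leRHS]mulrDl.
  apply: (le_trans (ler_normD _ _)); apply: lerD; first exact: psi_n.
  rewrite normrM; apply: ler_pM => //; first exact: ltW.
  by have := cauchy_schwarz ip_inner g (x n); rewrite x_unit mulr1.
(* The factor 4 pays for [normalized_combination], and the bound 1/2 supplies its near-orthogonality
   hypothesis. *)
have [e' [e'0 e'e e'2]] : exists e' : R[i], [/\ 0 < e', e' *+ 4 <= e & e' <= 2^-1].
  have e4 : 0 < e / 4 by rewrite divr_gt0.
  have e4e : e / 4 *+ 4 <= e by rewrite -mulr_natr divfK ?pnatr_eq0.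
  have half0 : 0 < 2^-1 :> R[i] by rewrite invr_gt0.
  case/orP: (real_leVge (gtr0_real e4) (gtr0_real half0)) => le.
    by exists (e / 4).
  by exists 2^-1; split=> //; apply: le_trans e4e; rewrite lerMn2r le orbT.
pose good y := [/\ D y, N y = 1, forall h, h \in hs -> ip h y = 0,
    forall g, D g -> `|ip (shifted lam g) y| <= e' * N g &
    forall t, t \in ts -> `|ip t y| <= e'].
have combine u w : good u -> good w -> `|ip u w| <= 2^-1 ->
    `|ip h u| <= `|ip h w| ->
  exists y, [/\ D y, N y = 1, forall h', h' \in h :: hs -> ip h' y = 0,
    forall g, D g -> `|ip (shifted lam g) y| <= e * N g &
    forall t, t \in ts -> `|ip t y| <= e].
  move=> [Du Nu hsu bu tu] [Dw Nw hsw bw tw] uw hle.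
  (* This makes [u - c *: w] orthogonal to [h]; the conjugate is there because [ip] is
     conjugate-linear on the right. If [ip h w = 0], then [ip h u = 0] by [hle], and the value 0 of
     the quotient is the right one. *)
  pose c := Num.conj (ip h u / ip h w).
  have c1 : `|c| <= 1.
    rewrite norm_conjC normf_div.
    have [->|hw0] := eqVneq (ip h w) 0; first by rewrite normr0 invr0 mulr0 ler01.
    by rewrite ler_pdivrMr ?normr_gt0 // mul1r.
  have [a [Ny bnd]] := normalized_combination ip_inner Nu uw c1.
  exists (a *: (u - c *: w)); split=> //.
  - apply: lin_subspaceZ => //; rewrite addrC -scaleNr; exact: lin_subspace_sum.
  - move=> h'; rewrite inE ipZr // ipBr // ipZr // conjCK => /orP[/eqP ->|h's].
      have [hw0|hw0] := eqVneq (ip h w) 0; last by rewrite divfK // subrr mulr0.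
      move: hle; rewrite hw0 normr0 normr_le0 => /eqP ->.
      by rewrite mulr0 subrr mulr0.
    by rewrite (hsu h') // (hsw h') // mulr0 subrr mulr0.
  - move=> g Dg; apply: (le_trans (bnd _ _ (bu _ Dg) (bw _ Dg))).
    by rewrite -mulrnAl ler_wpM2r ?hnorm_ge0.
  - by move=> t tts; apply: (le_trans (bnd _ _ (tu _ tts) (tw _ tts))).
have [y1 [Dy1 Ny1 hs1 b1 t1]] := IHhs e' ts e'0.
have [y2 [Dy2 Ny2 hs2 b2 t2]] := IHhs e' (y1 :: ts) e'0.
have y12 : `|ip y1 y2| <= 2^-1 by apply: le_trans e'2; apply: t2; exact: mem_head.
have good1 : good y1 by [].
have good2 : good y2 by split=> // t tts; apply: t2; rewrite inE tts orbT.
case/orP: (real_leVge (normr_real (ip h y1)) (normr_real (ip h y2))) => le.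
  exact: combine le.
by apply: combine le => //; rewrite ip_norm_sym.
Qed.

Lemma polluting_vanishing (fs : seq V) (e : R[i]) :
    (forall f, f \in fs -> D f) -> 0 < e ->
  exists s m, polluting lam fs e s m.
Proof.
move=> fsD e0; have e2 : 0 < e / 2 by rewrite divr_gt0.
(* Orthogonality to both [f] and [T f] gives [ip (shifted m f) y = 0] for every [m], so [m] can be
   chosen to suit [y] itself. Halving [e] turns the weak bound into a strict one. *)
have [y [Dy Ny hsy by_ _]] := approx_orth (fs ++ map T fs) [::] e2.
have yy : ip y y = 1 by rewrite -hnorm_sqr // Ny expr1n.
exists (y :: fs), (ip (T y) y); split.
- by move=> v; rewrite inE => /orP[/eqP ->|/fsD].
- have := by_ _ Dy; rewrite ipBl // ipZl // yy mulr1 Ny mulr1 distrC => /le_lt_trans.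
  by apply; rewrite ltr_pdivrMr // ltr_pMr // ltr1n.
- move=> f ffs; exists f; first by rewrite inE ffs orbT.
  by rewrite subrr /hnorm ip0l // sqrtC0.
exists y; split; first exact: mem_head.
  by apply: contra_eq_neq yy => ->; rewrite ip0l // eq_sym oner_eq0.
move=> v; rewrite inE /shifted ipBl // ipZl // => /orP[/eqP ->|vfs].
  by rewrite yy mulr1 subrr.
by rewrite (hsy v) ?(hsy (T v)) ?mulr0 ?subrr ?mem_cat ?vfs ?map_f ?orbT.
Qed.
End Vanishing.

Lemma exists_polluting (fs : seq V) (e : R[i]) :
    (forall f, f \in fs -> D f) -> 0 < e ->
  exists s m, polluting lam fs e s m.
Proof.
move=> fsD e0.
have [[d [n0 [d0 big]]]|small] := pselect (exists (d : R[i]) n0, 0 < d /\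
    forall n, (n0 <= n)%N -> exists2 g, D g & d * N g < `|psi n g|).
  exact: polluting_nonvanishing d0 big fsD e0.
apply: polluting_vanishing fsD e0 => d n0 d0.
apply: contrapT => none; apply: small; exists d, n0; split=> // n n0n.
apply: contrapT => no_g; apply: none; exists n => // g Dg.
(* The order on [R[i]] is partial, so negating a strict inequality requires both sides to be
   real. *)
have dNg : d * N g \is Num.real by rewrite ger0_real // mulr_ge0 ?hnorm_ge0 // ltW.
rewrite real_leNgt ?normr_real //.
by apply/negP => lt; apply: no_g; exists g.
Qed.
End Sequence.
End Pollution.

(** * Assembling the subspaces along a dense sequence *)

Lemma harmonic_small (R : realType) (e : R[i]) : 0 < e ->
  exists n0, forall n, (n0 <= n)%N -> n.+1%:R^-1 < e.
Proof.
case: e => r i; rewrite ltcE /= => /andP[/eqP -> r0].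
exists (Num.bound r^-1) => n n0n.
have -> : n.+1%:R^-1 = (n.+1%:R^-1 : R)%:C%C by rewrite fmorphV rmorph_nat.
rewrite -[ltRHS]/(r%:C%C) ltcR invf_plt ?posrE //.
apply: (lt_le_trans (archi_boundP _)).
  by rewrite invr_ge0 ltW.
by rewrite ler_nat leqW.
Qed.

Theorem theorem6p3 (R : realType) (V : lmodType R[i]) (ip : V -> V -> R[i])
  (hH : separable_inf_dim_hilbert ip)
  (D : set V) (T : V -> V)
  (hD : lin_subspace D) (hT : linear_on D T) (hdense : dense ip D)
  (lam : R[i]) (hlam : ess_num_range ip D T lam) :
  exists (Hs : nat -> set V) (P : nat -> V -> V),
    [/\ (forall n, [/\ fin_dim_subspace (Hs n), Hs n `<=` D & orth_proj ip (Hs n) (P n)]),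
        (forall x : V, cvgV ip (fun n => P n x) x),
        (forall e : R[i], 0 < e -> exists N : nat, forall n, (N <= n)%N ->
            exists mu, compr_spectrum ip (Hs n) (P n) T mu /\ `|lam - mu| < e) &
        (~ spectrum ip setT D T lam -> spurious_eigenvalue ip D T Hs P lam)].
Proof.
case: hH => ip_inner _ [d d_dense] _; case: hlam => x [xD x_unit x_weak mu_lim].
have inv_gt0 n : 0 < n.+1%:R^-1 :> R[i] by rewrite invr_gt0 ltr0Sn.
(* The dense sequence [d] need not lie in [D], so each [d j] is replaced at stage [n] by a nearby
   vector of [D]. *)
have /choice[f f_near] n : exists f : nat -> V,
    forall j, D (f j) /\ hnorm ip (d j - f j) < n.+1%:R^-1.
  have /choice[f fP] j := hdense (d j) _ (inv_gt0 n).
  by exists f.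
pose fs n := [seq f n j | j <- iota 0 n.+1].
have /choice[s /choice[mu sP]] n :
    exists s mu, polluting ip D T lam (fs n) n.+1%:R^-1 s mu.
  apply: (exists_polluting ip_inner hD hT xD x_unit x_weak mu_lim) (inv_gt0 n).
  by move=> _ /mapP[j _ ->]; have [] := f_near n j.
have /choice[P PP] n := orth_proj_lspan ip_inner (s n).
have mu_spec n : compr_spectrum ip (lspan (s n)) (P n) T (mu n).
  have [sD _ _ [y [ys y0 orty]]] := sP n.
  apply: (compr_spectrum_orth ip_inner (PP n) (mem_lspan ys) y0).
  exact: (shifted_orth_lspan ip_inner hD hT sD orty).
have mu_lam e : 0 < e -> exists n0, forall n, (n0 <= n)%N -> `|lam - mu n| < e.
  move=> /harmonic_small[n0 h]; exists n0 => n /h; apply: lt_trans.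
  by have [] := sP n.
exists (fun n => lspan (s n)), P; split.
- move=> n; split=> //; first exact: fin_dim_lspan.
  by apply: lspan_min => //; have [] := sP n.
- move=> z e e0; have e3 : 0 < e / 3 by rewrite divr_gt0.
  have [j zdj] := d_dense z _ e3; have [n0 h] := harmonic_small _ _ e3.
  (* [j <= n] puts [f n j] in the list [fs n]. The three thirds of [e] bound the distances from [z]
     to [d j], to [f n j], and to a vector [g] of the span. *)
  exists (maxn j n0) => n; rewrite geq_max => /andP[jn /h {}h].
  have [_ _ near_s _] := sP n.
  have [] := near_s (f n j); first by apply: map_f; rewrite mem_iota ltnS.
  move=> g gs fg; have [_ df] := f_near n j.
  have := orth_proj_best ip_inner z (lspan_lin (s n)) (PP n) (mem_lspan gs).
  move=> /le_lt_trans; apply.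
  have -> : z - g = (z - d j) + ((d j - f n j) + (f n j - g)) by rewrite !subrKA.
  have -> : e = e / 3 + (e / 3 + e / 3).
    by rewrite -!mulrDl -mulr2n -mulrS -[e *+ 3]mulr_natr mulfK ?pnatr_eq0.
  apply: (le_lt_trans (hnorm_triangle ip_inner _ _)); apply: ltrD => //.
  apply: (le_lt_trans (hnorm_triangle ip_inner _ _)); apply: ltrD.
    exact: lt_trans h.
  exact: lt_trans h.
- by move=> e /mu_lam[n0 h]; exists n0 => n /h lam_mu; exists (mu n).
(* Every index carries a spectral point [mu n], so the infinite index set is all of [nat]. *)
move=> lam_res; split=> //; exists setT, mu; split=> //; first exact: infinite_nat.
by move=> e /mu_lam[n0 h]; exists n0 => n _ /h; rewrite distrC.
Qed.
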